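(* Let $\mathbf A$ be a finite idempotent minimal Taylor algebra and $B\subseteq A$. The following are equivalent: (a) $B$ is $2$-absorbing in $\mathbf A$; (b) the relation $R=\{(x,y,z)\in A^3: x\in B \text{ or } y\in B\text{ or } z\in B\}$ is a subuniverse of $\mathbf A^3$; (c) $B$ is a projective subuniverse of $\mathbf A$; (d) $B$ is a strongly projective subuniverse of $\mathbf A$.
   Context: $B$ is $2$-absorbing if some binary term operation $t$ of $\mathbf A$ satisfies $t(a,b),t(b,a)\in B$ for all $a\in A$, $b\in B$. $B$ is a projective subuniverse if for every $n$-ary term operation $f$ there is a coordinate $i$ such that $f(\mathbf a)\in B$ whenever $a_i\in B$. $B$ is a strongly projective subuniverse if for every $n$-ary term operation $f$ and every essential coordinate $i$ of $f$ (one on which $f$ depends), $f(\mathbf a)\in B$ whenever $a_i\in B$. $\mathbf A$ is Taylor if no quotient of a subalgebra of a finite power of $\mathbf A$ is a two-element algebra all of whose operations are projections; minimal Taylor if it is Taylor and no reduct with strictly smaller clone of term operations is Taylor. *)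

(* Defs.v *)
From HB Require Import structures.
From mathcomp Require Import all_boot.

Set Implicit Arguments.
Unset Strict Implicit.
Unset Printing Implicit Defensive.

Local Open Scope quotient_scope.

(* An algebra with universe T, over its own signature: two algebras on the same
   universe (e.g. an algebra and a reduct of it) may have unrelated signatures.
   Nullary symbols and infinite signatures are allowed. *)
Record algebra (T : Type) := Algebra {
  symb : Type;
  arity : symb -> nat;
  op : forall s : symb, {ffun 'I_(arity s) -> T} -> T
}.

Section Clone.
Variables (T : Type) (A : algebra T).

Inductive term (n : nat) : Type :=
| Var of 'I_n
| App (s : symb A) of ('I_(arity s) -> term n).

Fixpoint eval n (t : term n) (x : {ffun 'I_n -> T}) : T :=
  match t with
  | Var i => x i
  | App s ts => op [ffun j => eval (ts j) x]
  end.

Definition term_op n (f : {ffun 'I_n -> T} -> T) : Prop :=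
  exists t : term n, forall x, f x = eval t x.

Definition idempotent_algebra : Prop :=
  forall (s : symb A) (a : T), op [ffun _ : 'I_(arity s) => a] = a.

End Clone.

(* A' is a reduct of A: the same universe, and Clo(A') is included in Clo(A). *)
Definition reduct T (A' A : algebra T) : Prop :=
  forall n (f : {ffun 'I_n -> T} -> T), term_op A' f -> term_op A f.

Definition proper_reduct T (A' A : algebra T) : Prop :=
  reduct A' A /\ ~ reduct A A'.

Definition power_algebra T (A : algebra T) (k : nat) :
    algebra {ffun 'I_k -> T} :=
  @Algebra _ (symb A) (@arity _ A)
    (fun s (x : {ffun 'I_(arity s) -> {ffun 'I_k -> T}}) =>
       [ffun j => op [ffun i => x i j]]).

(* The empty set is allowed as a subuniverse. *)
Definition subuniverse (T : finType) (A : algebra T) (S : {set T}) : Prop :=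
  forall (s : symb A) (x : {ffun 'I_(arity s) -> T}),
    (forall i, x i \in S) -> op x \in S.

Section Subalgebra.
Variables (T : finType) (A : algebra T) (S : {set T}).
Hypothesis subS : subuniverse A S.

Lemma subalgebra_closed (s : symb A)
    (x : {ffun 'I_(arity s) -> {a : T | a \in S}}) :
  op [ffun i => val (x i)] \in S.
Proof. by apply: subS => i; rewrite ffunE; apply: valP. Qed.

Definition subalgebra : algebra {a : T | a \in S} :=
  @Algebra _ (symb A) (@arity _ A)
    (fun s x => exist _ (op [ffun i => val (x i)]) (subalgebra_closed x)).

End Subalgebra.

Section Quotient.
Variables (T : choiceType) (A : algebra T) (e : equiv_rel T).

Definition congruence : Prop :=
  forall (s : symb A) (x y : {ffun 'I_(arity s) -> T}),
    (forall i, e (x i) (y i)) -> e (op x) (op y).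

(* The operations are computed on canonical representatives; when e is a
   congruence they do not depend on that choice, see quotient_op_pi. *)
Definition quotient_algebra : algebra {eq_quot e} :=
  @Algebra _ (symb A) (@arity _ A)
    (fun s x => \pi_{eq_quot e} (op [ffun i => repr (x i)])).

Lemma quotient_op_pi : congruence ->
  forall (s : symb A) (x : {ffun 'I_(arity s) -> T}),
    @op _ quotient_algebra s [ffun i => \pi_{eq_quot e} (x i)]
      = \pi_{eq_quot e} (op x).
Proof.
move=> eP s x; apply/eqmodP/eP => i.
by rewrite !ffunE; apply/eqmodP; rewrite reprK.
Qed.

End Quotient.

Definition two_element (T : Type) : Prop :=
  exists a b : T, a <> b /\ forall c : T, c = a \/ c = b.

Definition all_projections T (A : algebra T) : Prop :=
  forall s : symb A, exists i : 'I_(arity s),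
    forall x : {ffun 'I_(arity s) -> T}, op x = x i.

Definition taylor (T : finType) (A : algebra T) : Prop :=
  ~ exists (k : nat) (S : {set {ffun 'I_k -> T}})
      (subS : subuniverse (power_algebra A k) S)
      (e : equiv_rel {a : {ffun 'I_k -> T} | a \in S}),
      [/\ congruence (subalgebra subS) e,
          two_element {eq_quot e}
        & all_projections (quotient_algebra (subalgebra subS) e)].

Definition minimal_taylor (T : finType) (A : algebra T) : Prop :=
  taylor A /\ forall A' : algebra T, proper_reduct A' A -> ~ taylor A'.

Section SpecialSubsets.
Variables (T : finType) (A : algebra T) (B : {set T}).

Definition two_absorbing : Prop :=
  exists t : {ffun 'I_2 -> T} -> T, term_op A t /\
    forall a b : T, b \in B ->
      t (finfun (tnth [tuple a; b])) \in B /\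
      t (finfun (tnth [tuple b; a])) \in B.

Definition projective : Prop :=
  forall n (f : {ffun 'I_n -> T} -> T), term_op A f ->
    exists i : 'I_n, forall a : {ffun 'I_n -> T}, a i \in B -> f a \in B.

Definition essential n (f : {ffun 'I_n -> T} -> T) (i : 'I_n) : Prop :=
  exists x y : {ffun 'I_n -> T},
    (forall j, j != i -> x j = y j) /\ f x <> f y.

Definition strongly_projective : Prop :=
  forall n (f : {ffun 'I_n -> T} -> T), term_op A f ->
    forall i : 'I_n, essential f i ->
      forall a : {ffun 'I_n -> T}, a i \in B -> f a \in B.

Definition or3_relation : {set {ffun 'I_3 -> T}} :=
  [set x : {ffun 'I_3 -> T} |
    [|| x (@Ordinal 3 0 isT) \in B,
        x (@Ordinal 3 1 isT) \in B
      | x (@Ordinal 3 2 isT) \in B]].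

End SpecialSubsets.

(* Main.v *)
Require Import Defs.
From mathcomp Require Import all_boot.
From mathcomp Require Import boolp.

(* No cyclic terms are needed. Non-Taylorness means that on some disjoint C, D in
   a power every operation acts as a projection; for idempotent algebras it is
   enough to see this for the term operations evaluated at a single pair
   (c, d) in C x D.
   (a) => (d): let A' consist of the term operations of A that fall into B as
   soon as one argument does. Were A' not Taylor, witnessed by C, D, then a
   binary 2-absorption witness would iterate to a g in A' with g(c,d) = c and
   g(d,c) = d for some c in C, d in D. Padding with g turns each term operation
   of A into one of A', so those of A act as projections on {c, d} as well,
   contradicting that A is Taylor. By minimality A and A' are equivalent.
   (b) => (a): if no binary term witnesses 2-absorption, then for each term
   operation f the sets of coordinates I such that f may leave B although its
   arguments in I lie in B form a prime ideal, R ruling out three such sets that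
   cover all coordinates. So f absorbs B through exactly one coordinate, and this
   coordinate yields projections on the pair of binary projections. *)

Set Implicit Arguments.
Unset Strict Implicit.
Unset Printing Implicit Defensive.

Local Open Scope quotient_scope.

(** * Term operations, their composition, and pairs as binary tuples *)

Section TermOperations.
Variables (T : Type) (A : algebra T).

Lemma eq_term_op n (f f' : {ffun 'I_n -> T} -> T) :
  f =1 f' -> term_op A f -> term_op A f'.
Proof. by move=> ff' [t ft]; exists t => x; rewrite -ff'. Qed.

Lemma term_op_var n (i : 'I_n) : term_op A (fun x : {ffun 'I_n -> T} => x i).
Proof. by exists (Var A i). Qed.

Lemma term_op_app n (s : symb A) (g : 'I_(arity s) -> {ffun 'I_n -> T} -> T) :
  (forall j, term_op A (g j)) -> term_op A (fun x => op [ffun j => g j x]).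
Proof.
move=> /fin_all_exists[t gt]; exists (App t) => x /=; congr op.
by apply/ffunP => j; rewrite !ffunE.
Qed.

Lemma term_op_symb (s : symb A) : term_op A (@op _ A s).
Proof.
apply: eq_term_op (term_op_app (fun j => term_op_var j)) => x /=.
by congr op; apply/ffunP => j; rewrite ffunE.
Qed.

Lemma idempotent_term_op n (f : {ffun 'I_n -> T} -> T) (a : T) :
  idempotent_algebra A -> term_op A f -> f [ffun=> a] = a.
Proof.
move=> idA [t ->]; elim: t => [i|s ts IH] /=; first by rewrite ffunE.
by rewrite -[RHS](idA s a); congr op; apply/ffunP => j; rewrite !ffunE IH.
Qed.

End TermOperations.

(* The case [A' = A] is closure under composition; it also applies to a reduct
   [A'] given by term operations of [A]. *)
Lemma term_op_comp T (A A' : algebra T) n m (f : {ffun 'I_n -> T} -> T)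
    (g : 'I_n -> {ffun 'I_m -> T} -> T) :
    (forall s : symb A', term_op A (@op _ A' s)) ->
    term_op A' f -> (forall j, term_op A (g j)) ->
  term_op A (fun x => f [ffun j => g j x]).
Proof.
move=> opA [t ft] gA.
apply: (@eq_term_op _ _ _ (fun x => eval t [ffun j => g j x])) => [x|].
  by rewrite ft.
elim: t {f ft} => [i|s ts IH] /=.
  by apply: eq_term_op (gA i) => x; rewrite ffunE.
have [u opu] := opA s.
have [v tsv] := fin_all_exists IH.
suff [w uw] : term_op A (fun x => eval u [ffun j => eval (v j) x]).
  exists w => x; rewrite -uw opu; congr eval.
  by apply/ffunP => j; rewrite !ffunE tsv.
elim: u {opu} => [i|s' us IHu] /=.
  by exists (v i) => x; rewrite ffunE.
exact: term_op_app IHu.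
Qed.

Lemma reduct_term_op T (A A' : algebra T) :
  (forall s : symb A', term_op A (@op _ A' s)) -> reduct A' A.
Proof.
move=> opA n f fA'.
have := term_op_comp opA fA' (fun j => term_op_var A j).
by apply: eq_term_op => x; congr f; apply/ffunP => j; rewrite ffunE.
Qed.

Definition pair2 T (a b : T) : {ffun 'I_2 -> T} := finfun (tnth [tuple a; b]).

Lemma pair2_0 T (a b : T) : pair2 a b ord0 = a.
Proof. by rewrite ffunE. Qed.

Lemma pair2_1 T (a b : T) : pair2 a b ord_max = b.
Proof. by rewrite ffunE. Qed.

Lemma ord2_case (P : 'I_2 -> Prop) : P ord0 -> P ord_max -> forall i, P i.
Proof.
by move=> P0 P1 [[|[|//]] lti]; [move: P0|move: P1]; congr P; apply: val_inj.
Qed.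

Lemma pair2_map T U (h : T -> U) (a b : T) :
  [ffun j => h (pair2 a b j)] = pair2 (h a) (h b).
Proof.
by apply/ffunP; apply: ord2_case; rewrite !ffunE.
Qed.

Lemma pair2_diag T (a : T) : pair2 a a = [ffun=> a].
Proof. by apply/ffunP; apply: ord2_case; rewrite !ffunE. Qed.

Lemma term_op_pair T (A : algebra T) n (f : {ffun 'I_2 -> T} -> T)
    (g h : {ffun 'I_n -> T} -> T) :
    term_op A f -> term_op A g -> term_op A h ->
  term_op A (fun x => f (pair2 (g x) (h x))).
Proof.
move=> fA gA hA.
have ghA j : term_op A (pair2 g h j).
  by elim/ord2_case: j; rewrite ffunE.
apply: eq_term_op (term_op_comp (@term_op_symb _ A) fA ghA) => x.
by rewrite (pair2_map (fun u => u x)).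
Qed.

(** * Term operations acting coordinatewise on powers *)

Definition lift_op T n k (f : {ffun 'I_n -> T} -> T)
    (x : {ffun 'I_n -> {ffun 'I_k -> T}}) : {ffun 'I_k -> T} :=
  [ffun j => f [ffun i => x i j]].

Section Powers.
Variables (T : Type) (A : algebra T) (k : nat).

Lemma idempotent_power : idempotent_algebra A -> idempotent_algebra (power_algebra A k).
Proof.
move=> idA s a; apply/ffunP => j; rewrite ffunE -[RHS](idA s).
by congr op; apply/ffunP => i; rewrite !ffunE.
Qed.

Lemma term_op_powerP n F :
  term_op (power_algebra A k) F ->
  exists2 f : {ffun 'I_n -> T} -> T, term_op A f & F =1 lift_op f.
Proof.
case=> t Ft.
suff [f fA tf] : exists2 f : {ffun 'I_n -> T} -> T, term_op A f & eval t =1 lift_op f.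
  by exists f => // x; rewrite Ft tf.
elim: t {F Ft} => [i|s ts IH].
  exists (fun x => x i); first exact: term_op_var.
  by move=> x; apply/ffunP => j; rewrite !ffunE.
have {}IH j : exists f : {ffun 'I_n -> T} -> T, term_op A f /\ eval (ts j) =1 lift_op f.
  by have [f] := IH j; exists f.
have [f fP] := fin_all_exists IH.
exists (fun x => @op _ A s [ffun j => f j x]).
  by apply: term_op_app => j; have [] := fP j.
move=> x; apply/ffunP => l; rewrite !ffunE; congr op.
by apply/ffunP => j; rewrite !ffunE -/(eval _ x) (fP j).2 ffunE.
Qed.

End Powers.

Lemma subuniverse_lift_op (T : finType) (A : algebra T) k n
    (R : {set {ffun 'I_k -> T}}) (f : {ffun 'I_n -> T} -> T)
    (x : {ffun 'I_n -> {ffun 'I_k -> T}}) :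
    subuniverse (power_algebra A k) R -> term_op A f ->
    (forall i, x i \in R) ->
  lift_op f x \in R.
Proof.
move=> subR [t ft] xR.
have -> : lift_op f x = lift_op (eval t) x.
  by apply/ffunP => j; rewrite !ffunE ft.
elim: t {f ft} => [i|s ts IH].
  suff -> : lift_op (eval (Var A i)) x = x i by apply: xR.
  by apply/ffunP => j; rewrite ffunE /= ffunE.
suff -> : lift_op (eval (App ts)) x =
    @op _ (power_algebra A k) s [ffun j => lift_op (eval (ts j)) x].
  by apply: subR => i; rewrite ffunE.
apply/ffunP => l; rewrite !ffunE /=; congr op.
by apply/ffunP => j; rewrite !ffunE.
Qed.

(** * A two-set criterion for being Taylor *)

Definition projecting (U : finType) (P : algebra U) (C D : {set U}) : Prop :=
  [/\ exists c, c \in C, exists d, d \in D, [disjoint C & D]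
    & forall s : symb P, exists i, forall x : {ffun 'I_(arity s) -> U},
        (forall j, x j \in C :|: D) -> op x \in if x i \in C then C else D].

(** Given [C] and [D], the subalgebra on [C :|: D] modulo the partition into [C] and [D] is a
    two-element algebra of projections. Conversely, the two classes of such a quotient, seen as
    subsets of the power, serve as [C] and [D]. *)
Lemma taylorP (T : finType) (A : algebra T) :
  taylor A <-> ~ exists k C D, projecting (power_algebra A k) C D.
Proof.
split=> tA; apply: contra_not tA.
- case=> k [C [D [[c cC] [d dD] CD pr]]].
  have opS (s : symb A) (x : {ffun 'I_(arity s) -> {ffun 'I_k -> T}}) i :
      (forall j, x j \in C :|: D) ->
      @op _ (power_algebra A k) s x \in (if x i \in C then C else D) ->
      @op _ (power_algebra A k) s x \in C :|: D /\
      (@op _ (power_algebra A k) s x \in C) = (x i \in C).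
    move=> xS; rewrite inE; case: ifP => [_ ->//|_ oD].
    by rewrite oD orbT (disjointFl CD oD).
  have subS : subuniverse (power_algebra A k) (C :|: D).
    move=> s x xS; have [i /(_ x xS) oi] := pr s.
    by have [] := opS s x i xS oi.
  pose r (u v : {u : {ffun 'I_k -> T} | u \in C :|: D}) := (val u \in C) == (val v \in C).
  have rE : equiv_class_of r.
    by split=> [u|u v|v u w]; rewrite /r ?eqxx // eq_sym // => /eqP->.
  pose e := EquivRelPack rE.
  have prE (s : symb A) : exists i, forall x : {ffun 'I_(arity s) -> {u | u \in C :|: D}},
      (val (@op _ (subalgebra subS) s x) \in C) = (val (x i) \in C).
    have [i iP] := pr s; exists i => x /=.
    have xS j : [ffun j => val (x j)] j \in C :|: D by rewrite ffunE; apply: valP.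
    by have [_ ->] := opS _ _ i xS (iP _ xS); rewrite ffunE.
  exists k, (C :|: D), subS, e; split.
  + move=> s x y exy; have [i iP] := prE s.
    by apply/eqP; rewrite !iP; apply/eqP/exy.
  + have cS : c \in C :|: D by rewrite inE cC.
    have dS : d \in C :|: D by rewrite inE dD orbT.
    exists (\pi_{eq_quot e} (exist _ c cS)), (\pi_{eq_quot e} (exist _ d dS)); split.
      by move/eqmodP/eqP => /=; rewrite cC (disjointFl CD dD).
    move=> q; rewrite -[q]reprK.
    have [qC|qC] := boolP (val (repr q) \in C); [left|right]; apply/eqmodP/eqP => /=.
      by rewrite cC qC.
    by rewrite (negPf qC) (disjointFl CD dD).
  + move=> s; have [i iP] := prE s; exists i => x.
    rewrite -[RHS]reprK; apply/eqmodP/eqP.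
    by rewrite [LHS]iP ffunE.
- case=> k [S [subS [e [cgr [qa [qb [ab abP]]] pr]]]].
  pose cls q := [set u | [exists v : {u | u \in S}, (val v == u) && (\pi_{eq_quot e} v == q)]].
  have clsP q u : reflect (exists2 v : {u | u \in S}, val v = u & \pi_{eq_quot e} v = q) (u \in cls q).
    rewrite inE; apply: (iffP existsP) => [[v /andP[/eqP vu /eqP vq]]|[v vu vq]].
      by exists v.
    by exists v; rewrite vu vq !eqxx.
  have in_cls q : exists u, u \in cls q.
    by exists (val (repr q)); apply/clsP; exists (repr q) => //; rewrite reprK.
  exists k, (cls qa), (cls qb); split=> //.
    rewrite -setI_eq0; apply/eqP/setP => u; rewrite inE [RHS]inE.
    apply/negP => /andP[/clsP[v vu va] /clsP[v' v'u v'b]].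
    by apply: ab; rewrite -va -v'b; congr (\pi_ _ _); apply: val_inj; rewrite vu v'u.
  move=> s; have [i iP] := pr s; exists i => x xS.
  have /fin_all_exists[v vx] j : exists v : {u | u \in S}, val v = x j.
    by have := xS j; rewrite inE => /orP[]/clsP[v]; exists v.
  pose y : {ffun 'I_(arity s) -> {u | u \in S}} := [ffun j => v j].
  have yx j : val (y j) = x j by rewrite ffunE vx.
  have xE : x = [ffun j => val (y j)] by apply/ffunP => j; rewrite ffunE yx.
  have opy q : \pi_{eq_quot e} (y i) = q -> @op _ (power_algebra A k) s x \in cls q.
    move=> yq; apply/clsP; exists (@op _ (subalgebra subS) s y); first by rewrite xE.
    rewrite -yq -(@quotient_op_pi _ _ _ cgr s y).
    by rewrite iP ffunE.
  case: ifP => xiC; apply: opy.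
    have /clsP[v' v'x <-] := xiC; congr (\pi_ _ _).
    by apply: val_inj; rewrite v'x yx.
  have [yq|//] := abP (\pi_{eq_quot e} (y i)).
  by move/negP: xiC; case; apply/clsP; exists (y i).
Qed.

(** * From projections on a single pair to projections on two sets *)

Section ProjectionsOnAPair.
Variables (U : finType) (P : algebra U) (c d : U) (C D : {set U}).
Hypothesis idP : idempotent_algebra P.
Hypothesis disCD : [disjoint C & D].

Let val_of (b : bool) : U := if b then c else d.
Let class_of (b : bool) : {set U} := if b then C else D.

Hypothesis projP : forall n (f : {ffun 'I_n -> U} -> U), term_op P f ->
  exists i, forall b : {ffun 'I_n -> bool},
    f [ffun j => val_of (b j)] \in class_of (b i).

Let class_inj u b b' : u \in class_of b -> u \in class_of b' -> b = b'.
Proof.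
case: b b' => [] [] //= uC uD; first by rewrite (disjointFr disCD uC) in uD.
by rewrite (disjointFl disCD uC) in uD.
Qed.

Let val_class b : val_of b \in class_of b.
Proof.
have [i] := projP (term_op_var P (ord0 : 'I_1)).
by rewrite [i]ord1 => /(_ [ffun=> b]); rewrite !ffunE.
Qed.

(* The projections [i] induced on the pair respect composition because they
   respect identification of variables and [P] is idempotent: below, the terms
   [s(t_1(x_1,y_1),...,t_n(x_n,y_n))] and [s(t_i(x_1,y_1),...,t_i(x_n,y_n))]
   agree when [x_j = y_j] for all [j] other than [i]. *)
Let symb_class (s : symb P) : exists i, forall t : 'I_(arity s) -> {ffun 'I_2 -> U} -> U,
  (forall j, term_op P (t j)) -> forall b : bool,
  t i (pair2 c d) \in class_of b -> op [ffun j => t j (pair2 c d)] \in class_of b.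
Proof.
set n := arity s.
have [i iP] := projP (term_op_symb s); exists i => t tP b tib.
(* The [n + n] coordinates stand for the variables x_j (left) and y_j (right): [pr] gives the index,
   [sd] the side. *)
pose pr (m : 'I_(n + n)) := match split m with inl j | inr j => j end.
pose sd (m : 'I_(n + n)) := if split m is inl _ then true else false.
have prl j : pr (lshift n j) = j by rewrite /pr (unsplitK (inl j)).
have prr j : pr (rshift n j) = j by rewrite /pr (unsplitK (inr j)).
have sdl j : sd (lshift n j) = true by rewrite /sd (unsplitK (inl j)).
have sdr j : sd (rshift n j) = false by rewrite /sd (unsplitK (inr j)).
pose star (u : 'I_n -> {ffun 'I_2 -> U} -> U) (x : {ffun 'I_(n + n) -> U}) :=
  op [ffun j => u j (pair2 (x (lshift n j)) (x (rshift n j)))].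
have starP u : (forall j, term_op P (u j)) -> exists m, forall b : {ffun 'I_(n + n) -> bool},
    star u [ffun j => val_of (b j)] \in class_of (b m).
  move=> uP; apply: projP; apply: term_op_app => j.
  by apply: term_op_pair (uP j) _ _; apply: term_op_var.
(* Setting x_j = y_j for all j turns [star u] into the basic operation by idempotence, so a
   coordinate describing [star u] has index [i]. *)
have pr_star u m : (forall j, term_op P (u j)) ->
    (forall b : {ffun 'I_(n + n) -> bool}, star u [ffun j => val_of (b j)] \in class_of (b m)) ->
    pr m = i.
  move=> uP /(_ [ffun l => pr l == i]); set x := [ffun _ => _].
  have -> : star u x = op [ffun j => val_of ([ffun l => l == i] j)].
    congr op; apply/ffunP => j; rewrite !ffunE prl prr pair2_diag.
    exact: idempotent_term_op.
  rewrite ffunE => /class_inj/(_ (iP _)); rewrite ffunE eqxx.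
  by move/eqP.
have [m mP] := starP t tP.
have [m' m'P] := starP (fun=> t i) (fun=> tP i).
have prm := pr_star _ _ tP mP; have prm' := pr_star _ _ (fun=> tP i) m'P.
have star_sd u : star u [ffun j => val_of ([ffun l => sd l] j)] = op [ffun j => u j (pair2 c d)].
  by congr op; apply/ffunP => j; rewrite !ffunE sdl sdr.
have mE : op [ffun j => t j (pair2 c d)] \in class_of (sd m).
  by have := mP [ffun l => sd l]; rewrite star_sd ffunE.
have m'E : t i (pair2 c d) \in class_of (sd m').
  by have := m'P [ffun l => sd l]; rewrite star_sd idP ffunE.
suff -> : b = sd m by [].
rewrite (class_inj tib m'E).
(* The test tuple has x_i = c, y_i = d and d elsewhere. The two terms agree there, which forces [m]
   and [m'] onto the same side. *)
have := m'P [ffun l => (pr l == i) && sd l].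
have := mP [ffun l => (pr l == i) && sd l].
rewrite !ffunE prm prm' eqxx /=; set x := [ffun _ => _].
suff -> : star t x = star (fun=> t i) x by move=> mS /class_inj; apply.
congr op; apply/ffunP => j; rewrite !ffunE !prl !prr sdl sdr.
by case: eqP => [->//|_] /=; rewrite pair2_diag !(idempotent_term_op _ idP (tP _)).
Qed.

(** [projP] controls only tuples over [c] and [d], so [C] and [D] are cut down to the elements
    generated by this pair. Each of these lies in [C] or [D], and by [symb_class] the basic
    operations act on them as projections. *)
Lemma projecting_of_pair : exists C' D', projecting P C' D'.
Proof.
pose gen u := `[< exists2 f, term_op P f & u = f (pair2 c d) >].
have genP u : gen u -> (u \in C) || (u \in D).
  move=> /asboolP[f fP ->]; have [i] := projP fP.
  move=> /(_ (pair2 true false)); rewrite (pair2_map val_of) /class_of.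
  by case: ifP => _ -> //; rewrite orbT.
exists [set u in C | gen u], [set u in D | gen u]; split.
- exists c; rewrite inE (val_class true) /=; apply/asboolP.
  by exists (fun x => x ord0); rewrite ?pair2_0 //; apply: term_op_var.
- exists d; rewrite inE (val_class false) /=; apply/asboolP.
  by exists (fun x => x ord_max); rewrite ?pair2_1 //; apply: term_op_var.
- rewrite -setI_eq0; apply/eqP/setP => u; rewrite !inE.
  by apply/negP => /andP[/andP[uC _] /andP[uD _]]; rewrite (disjointFr disCD uC) in uD.
move=> s; have [i iP] := symb_class s; exists i => x xCD.
have genx j : gen (x j).
  by have := xCD j; rewrite !inE => /orP[]/andP[].
have /fin_all_exists[t tx] j :
    exists f : {ffun 'I_2 -> U} -> U, term_op P f /\ x j = f (pair2 c d).
  by have /asboolP[f fP xf] := genx j; exists f.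
have xE : x = [ffun j => t j (pair2 c d)].
  by apply/ffunP => j; rewrite ffunE (tx j).2.
have tP j : term_op P (t j) := (tx j).1.
have genop : gen (op x).
  apply/asboolP; exists (fun y => op [ffun j => t j y]); first exact: term_op_app.
  by rewrite {1}xE.
have := iP t tP; rewrite -xE -(tx i).2 => {}iP.
rewrite !inE genx andbT; case: ifP => xiC; rewrite inE genop andbT.
  exact: (iP true).
apply: (iP false).
by have := genP _ (genx i); rewrite xiC.
Qed.

End ProjectionsOnAPair.

(** * 2-absorption and the reduct of absorbing operations *)

Lemma iter_periodic (W : finType) (h : W -> W) (x : W) :
  exists i N, iter N.+1 h (iter i h x) = iter i h x.
Proof.
have /trajectP[i lti hi] := looping_order h x.
exists i, (order h x - i).-1.
by rewrite prednK ?subn_gt0 // -iterD subnK ?hi // ltnW.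
Qed.

Section BinaryAbsorption.
Variables (T : finType) (A : algebra T) (B : {set T}).
Hypothesis idA : idempotent_algebra A.

Definition fully_absorbing n (f : {ffun 'I_n -> T} -> T) : Prop :=
  forall i (a : {ffun 'I_n -> T}), a i \in B -> f a \in B.

(** Each absorbing term operation is its own symbol. The clone contains the projections as well, so
    its members absorb only through essential coordinates. *)
Definition absorbing_reduct : algebra T :=
  @Algebra T
    {nf : {n & {ffun 'I_n -> T} -> T} |
      term_op A (projT2 nf) /\ fully_absorbing (projT2 nf)}
    (fun s => projT1 (sval s)) (fun s => projT2 (sval s)).

Lemma absorbing_reduct_term_op (s : symb absorbing_reduct) :
  term_op A (@op _ absorbing_reduct s).
Proof. by case: s => nf []. Qed.

Lemma lift_op_pair2 k (f : {ffun 'I_2 -> T} -> T) (u v : {ffun 'I_k -> T}) :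
  lift_op f (pair2 u v) = [ffun j => f (pair2 (u j) (v j))].
Proof.
by apply/ffunP => j; rewrite !ffunE (pair2_map (fun u : {ffun 'I_k -> T} => u j)).
Qed.

Section Iterates.
Variable f : {ffun 'I_2 -> T} -> T.

(** First component of the N-th iterate of (x,y) |-> (f(x,y), f(y,x)); swapping the arguments gives
    the second. *)
Fixpoint cross_iter N : {ffun 'I_2 -> T} -> T :=
  if N is N'.+1 then
    fun x => cross_iter N' (pair2 (f x) (f (pair2 (x ord_max) (x ord0))))
  else fun x => x ord0.

Lemma cross_iter_term_op N : term_op A f -> term_op A (cross_iter N).
Proof.
move=> fA; elim: N => [|N IH] /=; first exact: term_op_var.
by do ![apply: term_op_pair | apply: term_op_var | apply: fA | apply: IH].
Qed.

Lemma cross_iter_absorbing N : fully_absorbing f -> fully_absorbing (cross_iter N.+1).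
Proof.
move=> fB; elim: N => [|N IH] i x xB.
  by rewrite /= pair2_0; apply: fB xB.
by apply: (IH ord0); rewrite pair2_0; apply: fB xB.
Qed.

Lemma iter_lift_op k N (u v : {ffun 'I_k -> T}) :
  iter N (fun p => (lift_op f (pair2 p.1 p.2), lift_op f (pair2 p.2 p.1))) (u, v) =
  (lift_op (cross_iter N) (pair2 u v), lift_op (cross_iter N) (pair2 v u)).
Proof.
elim: N u v => [|N IH] u v.
  by congr pair; apply/ffunP => j; rewrite lift_op_pair2 ffunE /= pair2_0.
rewrite iterSr IH /=.
by congr pair; apply/ffunP => j; rewrite !lift_op_pair2 !ffunE.
Qed.

End Iterates.

(** Up to swapping its arguments, the 2-absorption witness f acts on [C] and [D] as the first
    projection. Then (u,v) |-> (f(u,v), f(v,u)) preserves the finite set C x D and has a periodic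
    point there, which an iterate fixes. *)
Lemma projecting_fixed_pair k C D :
    two_absorbing A B -> projecting (power_algebra absorbing_reduct k) C D ->
  exists g c d, [/\ term_op A g, fully_absorbing g, c \in C, d \in D
    & lift_op g (pair2 c d) = c /\ lift_op g (pair2 d c) = d].
Proof.
case=> f [fA fB] [[c0 c0C] [d0 d0D] disCD pr].
have {}fB : fully_absorbing f.
  move=> i x; rewrite (_ : x = pair2 (x ord0) (x ord_max)); last first.
    by apply/ffunP; apply: ord2_case; rewrite ?pair2_0 ?pair2_1.
  elim/ord2_case: i; rewrite ?pair2_0 ?pair2_1 => xB.
    by have [] := fB (x ord_max) _ xB.
  by have [] := fB (x ord0) _ xB.
have [g [gA gB gCD]] : exists g, [/\ term_op A g, fully_absorbing g
    & forall u v, u \in C -> v \in D ->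
        lift_op g (pair2 u v) \in C /\ lift_op g (pair2 v u) \in D].
  have [i iP] := pr (exist _ (existT _ 2 f) (conj fA fB)).
  have {}iP u v : u \in C :|: D -> v \in C :|: D ->
      lift_op f (pair2 u v) \in if pair2 u v i \in C then C else D.
    by move=> uS vS; apply: iP; apply: ord2_case; rewrite ?pair2_0 ?pair2_1.
  have inS u v : u \in C -> v \in D -> u \in C :|: D /\ v \in C :|: D.
    by rewrite !inE => -> ->; rewrite orbT.
  elim/ord2_case: i iP => iP.
    exists f; split=> // u v uC vD; have [uS vS] := inS u v uC vD.
    have := iP u v uS vS; have := iP v u vS uS.
    by rewrite !pair2_0 uC (disjointFl disCD vD).
  exists (fun x => f (pair2 (x ord_max) (x ord0))); split.
  - by apply: term_op_pair fA _ _; apply: term_op_var.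
  - by apply: ord2_case => x xB; [apply: (fB ord_max)|apply: (fB ord0)]; rewrite ?pair2_0 ?pair2_1.
  move=> u v uC vD; have [uS vS] := inS u v uC vD.
  have := iP u v uS vS; have := iP v u vS uS.
  rewrite !pair2_1 uC (disjointFl disCD vD) !lift_op_pair2.
  by split; [rewrite [X in X \in _](_ : _ = [ffun j => f (pair2 (v j) (u j))])
            |rewrite [X in X \in _](_ : _ = [ffun j => f (pair2 (u j) (v j))])] => //;
     apply/ffunP => j; rewrite !ffunE ?pair2_0 ?pair2_1.
pose h (p : {ffun 'I_k -> T} * {ffun 'I_k -> T}) := (lift_op g (pair2 p.1 p.2), lift_op g (pair2 p.2 p.1)).
have [i [N hN]] := iter_periodic h (c0, d0).
have : (iter i h (c0, d0)).1 \in C /\ (iter i h (c0, d0)).2 \in D.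
  by elim: i {hN} => [|i [IHC IHD]] //=; apply: gCD.
case: (iter i h (c0, d0)) hN => c d; rewrite iter_lift_op => -[cE dE] [cC dD].
(* The period is positive, which matters: the zeroth iterate is a projection and need not absorb. *)
exists (cross_iter g N.+1), c, d; split=> //.
- exact: cross_iter_term_op.
- exact: cross_iter_absorbing.
Qed.

(** Left-nested products by [g] starting at x_i: running through all variables they absorb in every
    argument, yet they return x_i wherever g(x_i,x_j) = x_i. *)
Definition absorb_along (g : {ffun 'I_2 -> T} -> T) m (i : 'I_m) (s : seq 'I_m)
    (x : {ffun 'I_m -> T}) : T :=
  foldl (fun u j => g (pair2 u (x j))) (x i) s.

Lemma absorb_along_term_op g m (i : 'I_m) s :
  term_op A g -> term_op A (absorb_along g i s).
Proof.
move=> gA; rewrite /absorb_along.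
elim/last_ind: s => [|s j IH]; first exact: term_op_var.
apply: eq_term_op (term_op_pair gA IH (term_op_var _ j)) => x.
by rewrite -cats1 foldl_cat.
Qed.

Lemma absorb_along_absorbing g m (i : 'I_m) :
  fully_absorbing g -> fully_absorbing (absorb_along g i (enum 'I_m)).
Proof.
move=> gB l x xB; rewrite /absorb_along.
have: l \in enum 'I_m by rewrite mem_enum.
elim/last_ind: (enum 'I_m) => //= s j IH; rewrite mem_rcons inE -cats1 foldl_cat /=.
case/orP => [/eqP lj|/IH sB].
  by apply: (gB ord_max); rewrite pair2_1 -lj.
by apply: (gB ord0); rewrite pair2_0.
Qed.

Lemma absorb_along_id g m (i : 'I_m) s (x : {ffun 'I_m -> T}) :
  (forall j, g (pair2 (x i) (x j)) = x i) -> absorb_along g i s x = x i.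
Proof. by move=> gx; rewrite /absorb_along; elim: s => //= j s; rewrite gx. Qed.

(* A term operation [t] of [A] is turned into the operation
   [g(g(t(x),w(y,z,x)),w(z,y,x))] of the reduct, where [w] is an iterate of [g];
   at [y = c], [z = d] and [x] ranging over [c], [d] this is
   [g(g(t(x),c),d)]. *)
Lemma absorbing_reduct_taylor :
  two_absorbing A B -> taylor A -> taylor absorbing_reduct.
Proof.
move=> absB /taylorP tA; apply/taylorP => -[k [C [D pr]]]; apply: tA.
have [g [c [d [gA gB cC dD [gcd gdc]]]]] := projecting_fixed_pair absB pr.
case: pr => _ _ disCD pr; exists k.
pose rho (u : {ffun 'I_k -> T}) := lift_op g (pair2 (lift_op g (pair2 u c)) d).
have gid (u : {ffun 'I_k -> T}) : lift_op g (pair2 u u) = u.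
  by apply/ffunP => j; rewrite lift_op_pair2 ffunE pair2_diag (idempotent_term_op _ idA gA).
have rhoc : rho c = c by rewrite /rho gid gcd.
have rhod : rho d = d by rewrite /rho gdc gid.
pose val_of (b : bool) := if b then c else d.
have gval b b' : lift_op g (pair2 (val_of b) (val_of b')) = val_of b.
  by case: b b' => [] [].
(* Padding changes a value u into [rho u], so the classes are pulled back along [rho], which fixes
   [c] and [d]. *)
apply: (@projecting_of_pair _ _ c d [set u | rho u \in C] [set u | rho u \in D]).
- exact: idempotent_power.
- rewrite -setI_eq0; apply/eqP/setP => u; rewrite !inE.
  by apply/negP => /andP[uC]; rewrite (disjointFr disCD uC).
move=> n F FP; have [f fA fF] := term_op_powerP FP.
pose m := n.+2; pose y0 : 'I_m := ord0; pose z0 : 'I_m := lift ord0 ord0.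
pose xj (j : 'I_n) : 'I_m := lift ord0 (lift ord0 j).
pose w i := absorb_along g i (enum 'I_m).
pose h (x : {ffun 'I_m -> T}) :=
  g (pair2 (g (pair2 (f [ffun j => x (xj j)]) (w y0 x))) (w z0 x)).
have hA : term_op A h.
  apply: (term_op_pair gA); last exact: absorb_along_term_op.
  apply: (term_op_pair gA); last exact: absorb_along_term_op.
  by apply: term_op_comp fA _ => j; [apply: term_op_symb|apply: term_op_var].
have hB : fully_absorbing h.
  move=> i x xB; apply: (gB ord_max); rewrite pair2_1.
  exact: absorb_along_absorbing xB.
have [i iP] := pr (exist _ (existT _ m h) (conj hA hB)).
(* [ext b] prescribes c at y, d at z, and follows [b] on the remaining variables. *)
pose ext (b : 'I_n -> bool) (l : 'I_m) :=
  if unlift ord0 l is Some l' then if unlift ord0 l' is Some j then b j else false else true.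
have exy b : ext b y0 = true by rewrite /ext unlift_none.
have exz b : ext b z0 = false by rewrite /ext liftK unlift_none.
have exx b j : ext b (xj j) = b j by rewrite /ext !liftK.
have {}iP (b : {ffun 'I_n -> bool}) :
    rho (F [ffun j => val_of (b j)]) \in if ext b i then C else D.
  have xS l : [ffun l => val_of (ext b l)] l \in C :|: D.
    by rewrite ffunE inE /val_of; case: (ext b l); rewrite ?cC ?dD ?orbT.
  have : lift_op h [ffun l => val_of (ext b l)] \in _ := iP _ xS.
  rewrite ffunE.
  have -> : (val_of (ext b i) \in C) = ext b i.
    by rewrite /val_of; case: (ext b i); rewrite ?cC ?(disjointFl disCD dD).
  suff -> : lift_op h [ffun l => val_of (ext b l)] = rho (F [ffun j => val_of (b j)]) by [].
  apply/ffunP => j.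
  have wE l : w l [ffun l' => [ffun l => val_of (ext b l)] l' j] = val_of (ext b l) j.
    rewrite /w absorb_along_id; first by rewrite !ffunE.
    move=> l'; rewrite !ffunE -[RHS](congr1 (fun u : {ffun 'I_k -> T} => u j) (gval _ (ext b l'))).
    by rewrite lift_op_pair2 ffunE.
  rewrite ffunE /h !wE /rho !lift_op_pair2 !ffunE.
  rewrite exy exz; congr (g (pair2 (g (pair2 _ _)) _)).
  by rewrite fF ffunE; congr f; apply/ffunP => l; rewrite !ffunE exx.
(* Constant tuples show by idempotence that the chosen coordinate is neither y nor z. *)
have class_b (b : {ffun 'I_n -> bool}) (b0 : bool) : (forall j, b j = b0) -> ext b i = b0.
  move=> bE; have := iP b.
  have -> : [ffun j => val_of (b j)] = [ffun=> val_of b0].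
    by apply/ffunP => j; rewrite !ffunE bE.
  rewrite (idempotent_term_op _ (idempotent_power (k := k) idA) FP).
  case: (ext b i) b0 {bE} => [] [] //=; rewrite ?rhoc ?rhod => uC.
    by rewrite (disjointFl disCD dD) in uC.
  by rewrite (disjointFr disCD cC) in uC.
have : exists j, i = xj j.
  have [l il|iy] := unliftP ord0 i; last first.
    by have := class_b [ffun=> false] false (ffunE _); rewrite iy exy.
  have [j lj|lz] := unliftP ord0 l; first by exists j; rewrite il lj.
  by have := class_b [ffun=> true] true (ffunE _); rewrite il lz exz.
case=> j ij; exists j => b; have := iP b; rewrite ij exx.
by case: (b j); rewrite inE.
Qed.

(** If a change at coordinate [i] alters a compound term, it alters an immediate subterm. By
    induction that subterm absorbs, and the outer operation absorbs through it. *)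
Lemma absorbing_term_op (A' : algebra T) n (f : {ffun 'I_n -> T} -> T) i :
    (forall s : symb A', fully_absorbing (@op _ A' s)) ->
    term_op A' f -> essential f i ->
  forall a : {ffun 'I_n -> T}, a i \in B -> f a \in B.
Proof.
move=> opB [t ft] [x [y [xy]]]; rewrite !ft => fxy a aB; rewrite ft.
elim: t {f ft} fxy => [j|s ts IH] /= fxy.
  suff -> : j = i by [].
  by apply/eqP; apply: contra_notT fxy => /xy.
have [j tj] : exists j, eval (ts j) x <> eval (ts j) y.
  apply: contrapT => tE; apply: fxy; congr op; apply/ffunP => j.
  by rewrite !ffunE; apply: contrapT => tj; apply: tE; exists j.
by apply: (opB s j); rewrite ffunE; apply: IH tj.
Qed.

Lemma two_absorbing_strongly_projective :
  minimal_taylor A -> two_absorbing A B -> strongly_projective A B.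
Proof.
move=> [tA minA] absB n f fA i fi a aB.
have redA : reduct A absorbing_reduct.
  apply: contrapT => nred; apply: (minA absorbing_reduct).
    by split=> //; apply: reduct_term_op; apply: absorbing_reduct_term_op.
  exact: absorbing_reduct_taylor.
apply: (@absorbing_term_op absorbing_reduct) (redA _ _ fA) fi _ aB.
by case=> nf [].
Qed.

(** * From the ternary relation to 2-absorption *)

Lemma or3_relation_two_absorbing :
    taylor A -> subuniverse (power_algebra A 3) (or3_relation B) ->
  two_absorbing A B.
Proof.
move=> /taylorP tA subR; apply: contrapT => nabs; apply: tA.
have absorbs n (f : {ffun 'I_n -> T} -> T) : term_op A f ->
    exists i, forall a : {ffun 'I_n -> T}, a i \in B -> f a \in B.
  move=> fA.
  pose fails (I : {set 'I_n}) :=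
    [exists a : {ffun 'I_n -> T}, [forall i in I, a i \in B] && (f a \notin B)].
  have failsP (I : {set 'I_n}) : reflect (exists2 a : {ffun 'I_n -> T},
      forall i, i \in I -> a i \in B & f a \notin B) (fails I).
    apply: (iffP existsP) => [[a /andP[/forall_inP aB fB]]|[a aB fB]]; first by exists a.
    by exists a; rewrite fB andbT; apply/forall_inP.
  (* Stacking the three failing tuples gives triples in R, one per coordinate, which [f] would map
     outside R. *)
  have no_cover (I1 I2 I3 : {set 'I_n}) : I1 :|: I2 :|: I3 = setT ->
      fails I1 -> fails I2 -> fails I3 -> False.
    move=> cov /failsP[a1 a1B f1] /failsP[a2 a2B f2] /failsP[a3 a3B f3].
    pose x := [ffun i => [ffun j : 'I_3 => tnth [tuple a1 i; a2 i; a3 i] j]].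
    have : lift_op f x \in or3_relation B.
      apply: subuniverse_lift_op subR fA _ => i.
      have : i \in I1 :|: I2 :|: I3 by rewrite cov inE.
      rewrite !inE !ffunE -orbA /tnth /=.
      by case/or3P => [/a1B|/a2B|/a3B] -> //; rewrite !orbT.
    have fx (a : {ffun 'I_n -> T}) j : (forall i, tnth [tuple a1 i; a2 i; a3 i] j = a i) ->
        lift_op f x j = f a.
      by move=> xa; rewrite ffunE; congr f; apply/ffunP => i; rewrite !ffunE xa.
    rewrite inE (fx a1) // (fx a2) // (fx a3) //.
    by rewrite (negPf f1) (negPf f2) (negPf f3).
  (* Otherwise identifying the variables inside [I] and those outside it yields a 2-absorption
     witness. *)
  have fails_or (I : {set 'I_n}) : fails I \/ fails (~: I).
    apply: contrapT => nI; apply: nabs.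
    pose g (u : {ffun 'I_2 -> T}) := f [ffun i => if i \in I then u ord0 else u ord_max].
    exists g; split.
      have := @term_op_comp _ A A n 2 f
        (fun i u => if i \in I then u ord0 else u ord_max) (@term_op_symb _ A) fA.
      by apply => j; case: (j \in I); apply: term_op_var.
    move=> a b bB; split; apply: contrapT => /negP gB; apply: nI; [right|left];
      apply/failsP; eexists; try exact: gB.
      by move=> i; rewrite inE ffunE => /negPf->; rewrite pair2_1.
    by move=> i iI; rewrite ffunE iI pair2_0.
  have nT : ~ fails setT.
    by move=> fT; apply: (no_cover setT setT setT) => //; rewrite !setUT.
  (* If every singleton failed, adding coordinates one by one to the empty set would make the full
     set fail. *)
  have [i nfi] : exists i, ~ fails [set i].
    apply: contrapT => nf; apply: (nT).
    have -> : setT = [set i in enum 'I_n] by apply/setP => i; rewrite !inE mem_enum.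
    elim: (enum 'I_n) => [|i s IH].
      have [|] := fails_or set0; first by congr fails; apply/setP => i; rewrite !inE.
      by rewrite setC0 => /nT.
    have fi : fails [set i] by apply: contrapT => nfi; apply: nf; exists i.
    have [//|fC] := fails_or [set j in i :: s].
    case: (@no_cover [set i] [set j in s] (~: [set j in i :: s])) => //.
    by apply/setP => j; rewrite !inE; case: (j == i); case: (j \in s).
  exists i => a aB; apply: contrapT => /negP faB; apply: nfi; apply/failsP.
  by exists a => // j; rewrite inE => /eqP->.
(* In the power indexed by [T ^ 2] an element generated by the two projections
   is a binary term operation; [C] and [D] collect those absorbing through
   exactly the first, resp. exactly the second, coordinate. *)
pose k := #|{: {ffun 'I_2 -> T}}|.
pose c : {ffun 'I_k -> T} := [ffun j => (enum_val j : {ffun 'I_2 -> T}) ord0].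
pose d : {ffun 'I_k -> T} := [ffun j => (enum_val j : {ffun 'I_2 -> T}) ord_max].
pose abs_at (v u : {ffun 'I_k -> T}) := [forall j, (v j \in B) ==> (u j \in B)].
exists k; apply: (@projecting_of_pair _ _ c d
  [set u | abs_at c u && ~~ abs_at d u] [set u | abs_at d u && ~~ abs_at c u]).
- exact: idempotent_power.
- rewrite -setI_eq0; apply/eqP/setP => u; rewrite !inE.
  by case: (abs_at c u); case: (abs_at d u).
move=> n F FP; have [f fA fF] := term_op_powerP FP.
have [i iP] := absorbs n f fA; exists i => b.
set x := [ffun j => _].
have xj j : x j = if b j then c else d by rewrite ffunE.
pose g (u : {ffun 'I_2 -> T}) := f [ffun l => if b l then u ord0 else u ord_max].
have gA : term_op A g.
  have := @term_op_comp _ A A n 2 f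
    (fun l u => if b l then u ord0 else u ord_max) (@term_op_symb _ A) fA.
  by apply => j; case: (b j); apply: term_op_var.
have Fg j : F x j = g (enum_val j).
  rewrite fF ffunE; congr f; apply/ffunP => l; rewrite !ffunE.
  by case: (b l); rewrite ffunE.
(* Absorbing through both coordinates would make [g] a 2-absorption witness. *)
have not_both : ~ (abs_at c (F x) /\ abs_at d (F x)).
  case=> /forallP cF /forallP dF; apply: nabs; exists g; split=> // a a' a'B; split.
    have := dF (enum_rank (pair2 a a')).
    by rewrite Fg !ffunE !enum_rankK pair2_1 a'B.
  have := cF (enum_rank (pair2 a' a)).
  by rewrite Fg !ffunE !enum_rankK pair2_0 a'B.
have absF : abs_at (if b i then c else d) (F x).
  apply/forallP => j; apply/implyP => vB; rewrite fF ffunE; apply: iP.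
  by rewrite ffunE xj.
by case: (b i) absF => absF; rewrite inE absF /=; apply/negP => absF'; apply: not_both.
Qed.

(** * Projectivity, strong projectivity and the ternary relation *)

Lemma projective_or3_relation :
  projective A B -> subuniverse (power_algebra A 3) (or3_relation B).
Proof.
move=> projB s x xR; have [i iP] := projB _ _ (@term_op_symb _ A s).
have opj j : x i j \in B -> @op _ (power_algebra A 3) s x j \in B.
  by move=> xB; rewrite ffunE; apply: iP; rewrite ffunE.
(* The triple [x i] meets [B] at some position, and the value then lies in [B] at the same
   position. *)
by have := xR i; rewrite !inE => /or3P[]/opj->; rewrite ?orbT.
Qed.

(* Otherwise the universe has at most one element and the algebra without
   operations is a Taylor proper reduct. *)
Lemma minimal_taylor_arity_gt0 n (f : {ffun 'I_n -> T} -> T) :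
  minimal_taylor A -> term_op A f -> 0 < n.
Proof.
case: n f => // f [_ minA] fA; exfalso.
pose A0 := @Algebra T void (fun=> 0) (fun s => match s with end).
have T1 (a b : T) : a = b.
  by rewrite -(idempotent_term_op a idA fA) -(idempotent_term_op b idA fA); congr f; apply/ffunP => -[].
apply: (minA A0).
  split; first by apply: reduct_term_op; case.
  by move=> /(_ _ _ fA)[[[]|[]]].
apply/taylorP => -[k [C [D [[c cC] [d dD] CD _]]]].
have cd : c = d by apply/ffunP => j; apply: T1.
by rewrite cd (disjointFl CD dD) in cC.
Qed.

Lemma inessential_const n (f : {ffun 'I_n -> T} -> T) :
  (forall i, ~ essential f i) -> forall x y, f x = f y.
Proof.
move=> ness x y.
(* The tuple [x] is turned into [y] one coordinate at a time. *)
have hyb (s : seq 'I_n) : f [ffun j => if j \in s then y j else x j] = f x.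
  elim: s => [|i s <-]; first by congr f; apply/ffunP => j; rewrite ffunE.
  apply: contrapT => fne; apply: (ness i); eexists; eexists; split; last exact: fne.
  by move=> j /negPf ji; rewrite !ffunE inE ji.
rewrite -(hyb (enum 'I_n)); congr f; apply/ffunP => j.
by rewrite ffunE mem_enum.
Qed.

(** An essential coordinate serves if there is one. Otherwise the operation is constant, and by
    idempotence its value equals any chosen argument; positive arity supplies one. *)
Lemma strongly_projective_projective :
  minimal_taylor A -> strongly_projective A B -> projective A B.
Proof.
move=> minA sprB n f fA; have n_gt0 := minimal_taylor_arity_gt0 minA fA.
have [[i fi]|ness] := EM (exists i, essential f i).
  by exists i; apply: sprB fi.
exists (Ordinal n_gt0) => a aB.
rewrite (@inessential_const _ f _ a [ffun=> a (Ordinal n_gt0)]).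
  by rewrite (idempotent_term_op _ idA fA).
by move=> i fi; apply: ness; exists i.
Qed.

End BinaryAbsorption.

Theorem mainTheorem13 (T : finType) (A : algebra T) (B : {set T}) :
  idempotent_algebra A -> minimal_taylor A ->
  [<-> two_absorbing A B;
       subuniverse (power_algebra A 3) (or3_relation B);
       projective A B;
       strongly_projective A B].
Proof.
move=> idA minA.
have ad := two_absorbing_strongly_projective (B := B) idA minA.
have dc := strongly_projective_projective (B := B) idA minA.
have cb := @projective_or3_relation _ A B.
have ba := or3_relation_two_absorbing (B := B) idA minA.1.
by tfae => [/ad/dc/cb|/ba/ad/dc|/cb/ba/ad|/dc/cb/ba].
Qed.
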